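(* Let $n\ge5$. With the alphabet $X=X_\Pi\cup X_\Sigma$, the map $\theta:X^*\to\mathcal{E}_n$ and the set of relations $R=R_\Pi\cup R_{\Pi\cup\Sigma}$ defined in the context, the monoid $\mathcal{E}_n=\mathrm{End}(\mathcal{T}_n)$ has monoid presentation $\langle X:R\rangle$ with respect to $\theta$; that is, $\theta$ is a surjective monoid homomorphism whose kernel $\{(v,w)\in X^*\times X^*: v\theta=w\theta\}$ is the congruence $R^\sharp$ on $X^*$ generated by $R$.
   Context: Maps are written on the right and composed left to right. $\mathcal{T}_n$ is the full transformation semigroup of all maps $\{1,\dots,n\}\to\{1,\dots,n\}$; $\mathcal{S}_n$, $\mathcal{A}_n$ are the symmetric and alternating groups, $\mathrm{id}$ the identity map, and $s^g=g^{-1}sg$ for $g\in\mathcal{S}_n$, $s\in\mathcal{T}_n$. $\mathcal{E}_n=\mathrm{End}(\mathcal{T}_n)$ is the monoid of all semigroup endomorphisms of $\mathcal{T}_n$ (not required to fix $\mathrm{id}$), and $\mathcal{G}_n=\mathrm{Aut}(\mathcal{T}_n)$. For $g\in\mathcal{S}_n$, $\psi_g:s\mapsto s^g$. For $t,e\in\mathcal{T}_n$, $\phi_{t,e}$ sends $s\mapsto t$ if $s\in\mathcal{S}_n\setminus\mathcal{A}_n$, $s\mapsto t^2$ if $s\in\mathcal{A}_n$, $s\mapsto e$ if $s\in\mathcal{T}_n\setminus\mathcal{S}_n$. By a known theorem of Schein and Teclezghi, $\mathcal{G}_n=\{\psi_g:g\in\mathcal{S}_n\}\cong\mathcal{S}_n$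 and, for $n\neq4$, $\mathcal{E}_n=\mathcal{G}_n\cup\{\phi_{t,e}: t^3=t,\ te=et=e^2=e\}$. The rank of $\alpha\in\mathcal{E}_n$ is the cardinality of its image. Its orbit is $\alpha\mathcal{G}_n$; the orbit is essential if $\alpha$ is not a product of one or more elements of $\mathcal{E}_n$ of strictly greater rank. Types of singular elements $\phi_{t,e}\in\mathcal{E}_n$: odd type if $t\in\mathcal{S}_n\setminus\mathcal{A}_n$, $e\ne\mathrm{id}$; even type if $t\in\mathcal{A}_n$, $e\neq\mathrm{id}$; non-permutation type if $t\in\mathcal{T}_n\setminus\mathcal{S}_n$; trivial type if $t=e=\mathrm{id}$. Generators: let $\Pi\cup\Sigma$ be a generating set for $\mathcal{E}_n$ consisting of a generating set $\Pi$ for $\mathcal{G}_n$ and a set $\Sigma$ containing exactly one element $\phi_{t,e}$ of each essential orbit other than $\mathcal{G}_n$. Let $X_\Pi=\{q_g:\psi_g\in\Pi\}$, $X_\Sigma=\{p_{t,e}:\phi_{t,e}\in\Sigma\}$, $X=X_\Pi\cup X_\Sigma$ (an alphabet of distinct letters), $X^*$ the free monoid on $X$, and $\theta:X^*\to\mathcal{E}_n$ the homomorphism with $p_{t,e}\theta=\phi_{t,e}$, $q_g\theta=\psi_g$. The type and rank of $p_{t,e}$ are those of $\phi_{t,e}$. Fix one letter of $X_\Sigma$ of each of odd, even, non-permutation and trivial type, denoted $p^{od},p^{ev},p^{np},p^{tr}$ respectively, with $p^{od},p^{ev},p^{np}$ of rank $3$ (this is possible), and $p^{tr}=p_{\mathrm{id},\mathrm{id}}$.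 Let $R_\Pi$ be any set of relations such that $\langle X_\Pi:R_\Pi\rangle$ is a monoid presentation of $\mathcal{S}_n$ (with respect to $q_g\mapsto g$). Let $F_\Pi(n)$ be the smallest number such that every element of $\mathcal{S}_n$ is represented by a word of length at most $F_\Pi(n)$ in the generators $X_\Pi$. Let $R_{\Pi\cup\Sigma}$ consist of the following relations, where $q_g,q_{g_i}$ range over $X_\Pi$, all $p_{*,*}$ range over $X_\Sigma$, and $0\le m\leq F_\Pi(n)$: (R1) $q_gp_{t,e}=p_{t,e}$; (R2) $p_{t,e}q_{g_1}\cdots q_{g_m}=p_{t,e}$ where $\phi_{t,e}\psi_{g_1}\cdots\psi_{g_m}=\phi_{t,e}$; (R3) $p_{t_1,e_1}p_{t_2,e_2}q_{g_1}\cdots q_{g_m}=p_{u_1,f_1}p_{u_2,f_2}$ where $\phi_{t_1,e_1}\phi_{t_2,e_2}\psi_{g_1}\cdots\psi_{g_m}=\phi_{u_1,f_1}\phi_{u_2,f_2}$ does not belong to an essential orbit; (R4) $p_{t,e}p_{u,f}=p_{t',e'}p_{u,f}$ where $p_{t,e}$ and $p_{t',e'}$ have the same type; (R5) $p^{od}p_{t,e}=p_{t,e}$; (R6) $p^{ev}p_{t,e}=p_{t,e}$ where $p_{t,e}$ has rank $2$; (R7) $p^{ev}p^{ev}p_{t,e}=p^{ev}p_{t,e}$; (R8) $p^{np}p^{ev}p_{t,e}=p^{np}p_{t,e}$, $p^{ev}p^{np}p_{t,e}=p^{np}p_{t,e}$ and $p^{np}p^{np}p_{t,e}=p^{np}p_{t,e}$;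 (R9) $p^{ev}p^{tr}=p^{tr}$, $p^{np}p^{tr}=p^{tr}$ and $p^{tr}p^{tr}=p^{tr}$; (R10) $p^{tr}p^{np}p_{t,e}=p^{np}p_{t,e}$, and $p^{tr}p_{u,f}=p^{tr}$ where $p_{u,f}$ has odd or even type. Put $R=R_\Pi\cup R_{\Pi\cup\Sigma}$. *)

(* Defs.v *)
From HB Require Import structures.
From mathcomp Require Import all_boot all_fingroup all_solvable.

Set Implicit Arguments.
Unset Strict Implicit.
Unset Printing Implicit Defensive.

Local Open Scope group_scope.

(* Monoid presentations; A^* is [seq A] under concatenation, with empty word [::]. *)

Section Presentations.
Variables (A : Type) (M : monoidType).

Inductive cong_closure (R : seq A -> seq A -> Prop) : seq A -> seq A -> Prop :=
| cong_base v w : R v w -> cong_closure R v w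
| cong_refl v : cong_closure R v v
| cong_sym v w : cong_closure R v w -> cong_closure R w v
| cong_trans u v w :
    cong_closure R u v -> cong_closure R v w -> cong_closure R u w
| cong_cat v w v' w' :
    cong_closure R v w -> cong_closure R v' w' ->
    cong_closure R (v ++ v') (w ++ w').

Definition word_eval (h : A -> M) (w : seq A) : M := \prod_(a <- w) h a.

Definition is_presentation (R : seq A -> seq A -> Prop) (theta : seq A -> M) :=
  [/\ theta [::] = 1,
      forall v w, theta (v ++ w) = theta v * theta w,
      forall x, exists w, theta w = x
    & forall v w, theta v = theta w <-> cong_closure R v w].

End Presentations.

(* The full transformation semigroup. Maps are written on the right, so
   [s * t] is "first s, then t", which is also the convention of {perm T}. *)

Definition trans (n : nat) := {ffun 'I_n -> 'I_n}.
HB.instance Definition _ n := Finite.on (trans n).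

Definition trans_mul n (s t : trans n) : trans n := [ffun i => t (s i)].
Definition trans_id n : trans n := [ffun i => i].

Lemma trans_mulA n : associative (@trans_mul n).
Proof. by move=> r s t; apply/ffunP=> i; rewrite !ffunE. Qed.
Lemma trans_mul1 n : left_id (trans_id n) (@trans_mul n).
Proof. by move=> s; apply/ffunP=> i; rewrite !ffunE. Qed.
Lemma trans_mulx1 n : right_id (trans_id n) (@trans_mul n).
Proof. by move=> s; apply/ffunP=> i; rewrite !ffunE. Qed.

HB.instance Definition _ n :=
  isMonoid.Build (trans n) (@trans_mulA n) (@trans_mul1 n) (@trans_mulx1 n).

Definition trans_of_perm n (g : 'S_n) : trans n := [ffun i => g i].

Definition symT n : {set trans n} := [set trans_of_perm g | g : 'S_n].
Definition altT n : {set trans n} :=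
  [set trans_of_perm g | g : 'S_n in 'Alt_('I_n)].

(* End(T_n): semigroup endomorphisms, not required to fix the identity. *)

Definition is_endo n (f : {ffun trans n -> trans n}) : bool :=
  [forall s : trans n, forall t : trans n, f (s * t) == f s * f t].

Record endo (n : nat) := Endo {
  endo_fun :> {ffun trans n -> trans n};
  endo_funP : is_endo endo_fun }.

HB.instance Definition _ n := [isSub for @endo_fun n].
HB.instance Definition _ n := [Finite of endo n by <:].

Lemma endoM n (a : endo n) (s t : trans n) : a (s * t) = a s * a t.
Proof. by have /forallP/(_ s)/forallP/(_ t)/eqP := endo_funP a. Qed.

Lemma endo_id_subproof n : is_endo [ffun s : trans n => s].
Proof. by apply/forallP=> s; apply/forallP=> t; rewrite !ffunE. Qed.
Lemma endo_mul_subproof n (a b : endo n) : is_endo [ffun s => b (a s)].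
Proof. by apply/forallP=> s; apply/forallP=> t; rewrite !ffunE !endoM. Qed.

Definition endo_id n : endo n := Endo (endo_id_subproof n).
Definition endo_mul n (a b : endo n) : endo n := Endo (endo_mul_subproof a b).

Lemma endo_mulA n : associative (@endo_mul n).
Proof. by move=> a b c; apply/val_inj/ffunP=> s; rewrite !ffunE /= ?ffunE. Qed.
Lemma endo_mul1 n : left_id (endo_id n) (@endo_mul n).
Proof. by move=> a; apply/val_inj/ffunP=> s; rewrite !ffunE. Qed.
Lemma endo_mulx1 n : right_id (endo_id n) (@endo_mul n).
Proof. by move=> a; apply/val_inj/ffunP=> s; rewrite !ffunE. Qed.

HB.instance Definition _ n :=
  isMonoid.Build (endo n) (@endo_mulA n) (@endo_mul1 n) (@endo_mulx1 n).

(* [endo n] acts on a finite type, so injective endomorphisms are automorphisms. *)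
Definition autT n : {set endo n} := [set a : endo n | injectiveb a].

Definition psi_fun n (g : 'S_n) : {ffun trans n -> trans n} :=
  [ffun s => trans_of_perm g^-1 * s * trans_of_perm g].

Lemma psi_subproof n (g : 'S_n) : is_endo (psi_fun g).
Proof.
apply/forallP=> s; apply/forallP=> t; apply/eqP/ffunP=> i.
by rewrite !ffunE permK.
Qed.

Definition psi n (g : 'S_n) : endo n := Endo (psi_subproof g).

Definition phi_fun n (t e : trans n) : {ffun trans n -> trans n} :=
  [ffun s => if s \in symT n :\: altT n then t
             else if s \in altT n then t * t else e].

(* The pairs (t, e) for which phi_{t,e} is an endomorphism. *)
Definition phi_index (n : nat) :=
  {te : trans n * trans n | is_endo (phi_fun te.1 te.2)}.

Definition phi n (i : phi_index n) : endo n := Endo (valP i).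

Definition endo_rank n (a : endo n) : nat := #|[set a s | s : trans n]|.

Definition endo_orbit n (a : endo n) : {set endo n} :=
  [set a * b | b in autT n].

Definition essential n (a : endo n) : Prop :=
  ~ exists w : seq (endo n),
      [/\ w != [::], all (fun b => endo_rank a < endo_rank b)%N w
        & \prod_(b <- w) b = a].

Definition essential_orbit n (O : {set endo n}) : Prop :=
  exists2 a : endo n, O = endo_orbit a & essential a.

Section Types.
Variables (n : nat) (i : phi_index n).
Let t := (val i).1.
Let e := (val i).2.

Definition odd_type := (t \in symT n :\: altT n) && (e != 1).
Definition even_type := (t \in altT n) && (e != 1).
Definition np_type := t \notin symT n.
Definition trivial_type := (t == 1) && (e == 1).

End Types.

Definition same_type n (i j : phi_index n) :=
  [|| odd_type i && odd_type j, even_type i && even_type j,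
      np_type i && np_type j | trivial_type i && trivial_type j].

(* For the finite group [autT n], generation as a monoid and as a group agree. *)
Definition generates n (A B : {set endo n}) : Prop :=
  A \subset B /\
  forall x, x \in B -> exists2 w, all [in A] w & \prod_(y <- w) y = x.

(* [autT n] is the orbit of the identity. A generating set of [autT n] together
   with such a Sigma generates [endo n], by downward induction on the rank. *)
Definition essential_transversal n (Sigma : {set endo n}) : Prop :=
  (forall a, a \in Sigma -> exists2 i : phi_index n, a = phi i &
     exists O, [/\ essential_orbit O, O <> autT n & a \in O]) /\
  (forall O, essential_orbit O -> O <> autT n -> #|Sigma :&: O| = 1%N).

Section Alphabet.
Variables (n : nat) (Pi Sigma : {set endo n}).

Definition X_Pi := {g : 'S_n | psi g \in Pi}.
Definition X_Sigma := {i : phi_index n | phi i \in Sigma}.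
Definition X := (X_Pi + X_Sigma)%type.

Definition S_eval : seq X_Pi -> 'S_n := word_eval (fun q => val q).

Definition theta : seq X -> endo n :=
  word_eval (fun x => match x with
                      | inl q => psi (val q)
                      | inr p => phi (val p)
                      end).

Definition words_cover (N : nat) : Prop :=
  forall g : 'S_n, exists2 w : seq X_Pi, (size w <= N)%N & S_eval w = g.

Definition is_F_Pi (F : nat) : Prop :=
  words_cover F /\ forall N, words_cover N -> (F <= N)%N.

Definition in_essential_orbit (a : endo n) : Prop :=
  exists2 O, essential_orbit O & a \in O.

Definition q_word (w : seq X_Pi) : seq X := map inl w.

Variables (F : nat) (R_Pi : seq X_Pi -> seq X_Pi -> Prop).
Variables (p_od p_ev p_np p_tr : X_Sigma).

Inductive R_Pi_Sigma : seq X -> seq X -> Prop :=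
| R1 (q : X_Pi) (p : X_Sigma) :
    R_Pi_Sigma [:: inl q; inr p] [:: inr p]
| R2 (p : X_Sigma) (w : seq X_Pi) :
    (size w <= F)%N ->
    theta (inr p :: q_word w) = theta [:: inr p] ->
    R_Pi_Sigma (inr p :: q_word w) [:: inr p]
| R3 (p1 p2 r1 r2 : X_Sigma) (w : seq X_Pi) :
    (size w <= F)%N ->
    theta ([:: inr p1; inr p2] ++ q_word w) = theta [:: inr r1; inr r2] ->
    ~ in_essential_orbit (theta [:: inr r1; inr r2]) ->
    R_Pi_Sigma ([:: inr p1; inr p2] ++ q_word w) [:: inr r1; inr r2]
| R4 (p p' r : X_Sigma) :
    same_type (val p) (val p') ->
    R_Pi_Sigma [:: inr p; inr r] [:: inr p'; inr r]
| R5 (p : X_Sigma) :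
    R_Pi_Sigma [:: inr p_od; inr p] [:: inr p]
| R6 (p : X_Sigma) :
    endo_rank (phi (val p)) = 2 ->
    R_Pi_Sigma [:: inr p_ev; inr p] [:: inr p]
| R7 (p : X_Sigma) :
    R_Pi_Sigma [:: inr p_ev; inr p_ev; inr p] [:: inr p_ev; inr p]
| R8a (p : X_Sigma) :
    R_Pi_Sigma [:: inr p_np; inr p_ev; inr p] [:: inr p_np; inr p]
| R8b (p : X_Sigma) :
    R_Pi_Sigma [:: inr p_ev; inr p_np; inr p] [:: inr p_np; inr p]
| R8c (p : X_Sigma) :
    R_Pi_Sigma [:: inr p_np; inr p_np; inr p] [:: inr p_np; inr p]
| R9a : R_Pi_Sigma [:: inr p_ev; inr p_tr] [:: inr p_tr]
| R9b : R_Pi_Sigma [:: inr p_np; inr p_tr] [:: inr p_tr]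
| R9c : R_Pi_Sigma [:: inr p_tr; inr p_tr] [:: inr p_tr]
| R10a (p : X_Sigma) :
    R_Pi_Sigma [:: inr p_tr; inr p_np; inr p] [:: inr p_np; inr p]
| R10b (p : X_Sigma) :
    odd_type (val p) || even_type (val p) ->
    R_Pi_Sigma [:: inr p_tr; inr p] [:: inr p_tr].

Definition R_all (v w : seq X) : Prop :=
  (exists v' w', [/\ R_Pi v' w', v = q_word v' & w = q_word w'])
  \/ R_Pi_Sigma v w.

End Alphabet.

(* Main.v *)
Require Import Defs.
From mathcomp Require Import all_boot all_fingroup all_solvable.
From Stdlib Require Import Classical.

Set Implicit Arguments.
Unset Strict Implicit.
Unset Printing Implicit Defensive.

Local Open Scope group_scope.

(** The hypothesis on Sigma says that every essential orbit other than that of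
    the identity is represented by some phi_{t,e}; downward induction on the
    rank then shows that Sigma and the automorphisms generate, and since every
    automorphism of T_n is inner the letters of X_Pi supply the automorphisms.
    So the evaluation map is onto.

    For the kernel, the point is that a product phi_{t,e} phi_{u,f} depends on
    the left factor only through its type: an element of odd type is a left
    identity, one of even type replaces (u, f) by (u^2, f), one of
    non-permutation type gives the constant endomorphism with value f, and one
    of trivial type that with value u^2. Automorphisms are absorbed by a
    singular element on their right. Hence in a word containing letters of X_Sigma the letters of X_Pi
    can be pushed to the end, every letter of X_Sigma but the last can be
    replaced by the fixed representative of its type, and relations between
    these four representatives leave at most one of them in front: every such
    word equals p u or c p u, with u a word over X_Pi ([word_shape],
    [p_word_rel]).

    A single letter p lies in an essential orbit by choice of Sigma. For a pair
    c p there is a dichotomy ([pair_rel]): either some relation collapses it to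
    a single letter, or its value is visibly a product of elements of larger
    rank: it has rank at most 2 and is a product of two elements of rank 3, or
    it is constant with singular value e, hence a product of an element of rank 3
    and phi_{id,e}. So whether the value of a normal form lies in an essential
    orbit tells single letters from pairs. Two single letters with values in
    the same orbit coincide because Sigma is a transversal, and the second
    family of relations applies; for two pairs the third family applies
    ([p_normal_rel]). Words without letters of X_Sigma evaluate to
    automorphisms, words with them do not, and on the former the given
    presentation of S_n is enough. *)

(** * Full transformations and their automorphisms *)

Lemma transM n (s t : trans n) i : (s * t) i = t (s i).
Proof. by rewrite ffunE. Qed.

Lemma trans1 n i : (1 : trans n) i = i.
Proof. by rewrite ffunE. Qed.

Lemma trans_of_permM n (g h : 'S_n) :
  trans_of_perm (g * h) = trans_of_perm g * trans_of_perm h.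
Proof. by apply/ffunP=> i; rewrite !ffunE permM. Qed.

Lemma trans_of_perm1 n : trans_of_perm (1 : 'S_n) = 1.
Proof. by apply/ffunP=> i; rewrite !ffunE perm1. Qed.

Lemma trans_of_perm_inj n : injective (@trans_of_perm n).
Proof. by move=> g h /ffunP gh; apply/permP=> i; have := gh i; rewrite !ffunE. Qed.

Lemma symTP n (s : trans n) : reflect (injective s) (s \in symT n).
Proof.
apply: (iffP imsetP) => [[g _ ->] x y|s_inj].
  by rewrite !ffunE; apply: perm_inj.
by exists (perm s_inj) => //; apply/ffunP=> i; rewrite !ffunE permE.
Qed.

Lemma altTE n (g : 'S_n) : (trans_of_perm g \in altT n) = ~~ g.
Proof.
rewrite -Alt_even; apply/imsetP/idP => [[h hA /trans_of_perm_inj ->] //|gA].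
by exists g.
Qed.

Lemma symT_perm n (g : 'S_n) : trans_of_perm g \in symT n.
Proof. exact: imset_f. Qed.

Lemma altT_sub n (s : trans n) : s \in altT n -> s \in symT n.
Proof. by case/imsetP=> g _ ->; apply: symT_perm. Qed.

Lemma symT1 n : (1 : trans n) \in symT n.
Proof. by rewrite -trans_of_perm1 symT_perm. Qed.

Lemma altT1 n : (1 : trans n) \in altT n.
Proof. by rewrite -trans_of_perm1 altTE odd_perm1. Qed.

Lemma symTM n (s t : trans n) : (s * t \in symT n) = (s \in symT n) && (t \in symT n).
Proof.
apply/idP/andP => [/symTP st_inj|[/imsetP[g _ ->] /imsetP[h _ ->]]]; last first.
  by rewrite -trans_of_permM symT_perm.
have s_inj : injective s by move=> x y sxy; apply: st_inj; rewrite !transM sxy.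
split; apply/symTP => // x y txy.
have [s' s'K Ks'] := injF_bij s_inj.
by rewrite -(Ks' x) -(Ks' y); congr (s _); apply: st_inj; rewrite !transM !Ks'.
Qed.

Lemma idempotent_perm n (e : trans n) : e * e = e -> e \in symT n -> e = 1.
Proof.
move=> ee /symTP e_inj; apply/ffunP=> i; rewrite trans1; apply: e_inj.
by rewrite -transM ee.
Qed.

Definition const_trans n (a : 'I_n) : trans n := [ffun=> a].

Lemma const_transM n (a : 'I_n) (s : trans n) : const_trans a * s = const_trans (s a).
Proof. by apply/ffunP=> i; rewrite !ffunE. Qed.

Lemma mul_const_trans n (a : 'I_n) (s : trans n) : s * const_trans a = const_trans a.
Proof. by apply/ffunP=> i; rewrite !ffunE. Qed.

Lemma const_trans_sing n (a : 'I_n) : (1 < n)%N -> const_trans a \notin symT n.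
Proof.
move=> n_gt1; apply/negP=> /symTP c_inj.
have: #|'I_n| <= 1 by apply/card_le1_eqP => x y _ _; apply: c_inj; rewrite !ffunE.
by rewrite card_ord leqNgt n_gt1.
Qed.

Lemma endo_eqP n (a b : endo n) : a =1 b -> a = b.
Proof. by move=> ab; apply/val_inj/ffunP. Qed.

Lemma endoME n (a b : endo n) s : (a * b) s = b (a s).
Proof. by rewrite /= ffunE. Qed.

Lemma endo1E n s : (1 : endo n) s = s.
Proof. by rewrite /= ffunE. Qed.

Lemma psiM n (g h : 'S_n) : psi (g * h) = psi g * psi h.
Proof.
apply: endo_eqP => s; rewrite endoME !ffunE invMg !trans_of_permM.
by rewrite !mulgA.
Qed.

Lemma psi1 n : psi (1 : 'S_n) = 1.
Proof. by apply: endo_eqP => s; rewrite endo1E !ffunE invg1 trans_of_perm1 mul1g mulg1. Qed.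

Lemma psiE n (g : 'S_n) (s : trans n) i : psi g s (g i) = g (s i).
Proof. by rewrite !ffunE permK. Qed.

Lemma psi_inj n (g : 'S_n) : injective (psi g).
Proof.
apply: (can_inj (g := psi g^-1)) => s.
by rewrite -endoME -psiM mulgV psi1 endo1E.
Qed.

Lemma psi_autT n (g : 'S_n) : psi g \in autT n.
Proof. by rewrite inE; apply/injectiveP/psi_inj. Qed.

Lemma psi_faithful n : injective (@psi n).
Proof.
move=> g h gh; apply/permP=> i.
have := psiE g (const_trans i) (g^-1 i); have := psiE h (const_trans i) (h^-1 i).
by rewrite gh /const_trans ![[ffun=> i] _]ffunE !permKV => <- <-.
Qed.

(** Constant maps are the elements z with s z = z for all s, so an automorphism
    permutes them; the induced permutation of points conjugates s to its image
    because of the identity c_i s = c_{s i}. *)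
Lemma autT_inner n (a : endo n) : a \in autT n -> exists g, a = psi g.
Proof.
rewrite inE => /injectiveP a_inj.
have [a' a'K Ka'] := injF_bij a_inj.
pose c i := a (const_trans i).
have c_const i : c i = const_trans (c i i).
  apply/ffunP=> j; rewrite [RHS]ffunE.
  have zc : const_trans j * c i = c i.
    by rewrite /c -(Ka' (const_trans j)) -endoM mul_const_trans.
  by rewrite -[in RHS]zc !ffunE.
have g_inj : injective (fun i => c i i).
  move=> i j cij; have: c i = c j by rewrite c_const cij -c_const.
  by move/a_inj/ffunP/(_ i); rewrite !ffunE.
exists (perm g_inj); apply: endo_eqP => s; apply/ffunP=> x.
rewrite -(permKV (perm g_inj) x); set i := _ x.
rewrite psiE !permE.
have: c (s i) = c i * a s by rewrite /c -endoM const_transM.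
by move/ffunP/(_ (s i)) => ->; rewrite transM [in RHS]c_const ffunE.
Qed.

(** * The singular endomorphisms phi_{t,e} *)

Section SingularEndomorphisms.
Variable n : nat.
Implicit Types (i j : phi_index n) (s t e : trans n).

Lemma phi_odd i s : s \in symT n :\: altT n -> phi i s = (val i).1.
Proof. by move=> s_odd; rewrite ffunE s_odd. Qed.

Lemma phi_alt i s : s \in altT n -> phi i s = (val i).1 * (val i).1.
Proof. by move=> s_alt; rewrite ffunE inE s_alt. Qed.

Lemma phi_sing i s : s \notin symT n -> phi i s = (val i).2.
Proof.
move=> s_sing; rewrite ffunE inE (negbTE s_sing) andbF.
by rewrite ifN //; apply: contra s_sing; apply: altT_sub.
Qed.

Lemma odd_transE (g : 'S_n) : (trans_of_perm g \in symT n :\: altT n) = odd_perm g.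
Proof. by rewrite inE altTE symT_perm negbK andbT. Qed.

Variant trans_class_spec s : Prop :=
| OddTrans of s \in symT n :\: altT n
| EvenTrans of s \in altT n
| SingTrans of s \notin symT n.

Lemma trans_classP s : trans_class_spec s.
Proof.
have [s_sym|] := boolP (s \in symT n); last by constructor 3.
have [|s_alt] := boolP (s \in altT n); first by constructor 2.
by constructor 1; rewrite inE s_alt.
Qed.

Lemma odd_transM s t :
  s \in symT n :\: altT n -> t \in symT n :\: altT n -> s * t \in altT n.
Proof.
move=> s_odd t_odd; move: (s_odd) (t_odd).
case/setDP: s_odd => /imsetP[g _ ->] _; case/setDP: t_odd => /imsetP[h _ ->] _.
by rewrite -trans_of_permM !odd_transE altTE odd_permM => -> ->.
Qed.

Lemma even_transM s t : s \in altT n -> t \in altT n -> s * t \in altT n.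
Proof.
move=> s_alt t_alt; move: (s_alt) (t_alt).
case/imsetP: s_alt => g _ ->; case/imsetP: t_alt => h _ ->.
by rewrite -trans_of_permM !altTE odd_permM => /negbTE-> /negbTE->.
Qed.

Lemma phi_one_subproof e : e * e = e -> is_endo (phi_fun 1 e).
Proof.
move=> ee; have E s : phi_fun 1 e s = if s \in symT n then 1 else e.
  rewrite ffunE inE mulg1; case: ifP => [/andP[_ ->] //|].
  by case: ifP => [/altT_sub -> //|_ /= ->].
apply/forallP=> s; apply/forallP=> t; rewrite !E symTM.
by case: (s \in _); case: (t \in _) => /=; rewrite ?mulg1 ?mul1g ?ee.
Qed.

(** The pair (id, e), valid for every idempotent e; the resulting phi_{id,e} is
    the right factor that exhibits constant endomorphisms as products. *)
Definition phi_one e (ee : e * e = e) : phi_index n :=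
  exist _ (1, e) (phi_one_subproof ee).

Hypothesis n_gt1 : (1 < n)%N.

Lemma exists_odd : exists s, s \in symT n :\: altT n.
Proof.
exists (trans_of_perm (tperm (Ordinal (ltnW n_gt1)) (Ordinal n_gt1))).
by rewrite odd_transE odd_tperm.
Qed.

Lemma exists_sing : exists s, s \notin symT n.
Proof. by exists (const_trans (Ordinal n_gt1)); apply: const_trans_sing. Qed.

(** The next four identities are the multiplicativity of phi_{t,e} read off at
    products of odd permutations and singular maps. *)
Lemma phi_index_cube i : (val i).1 * (val i).1 * (val i).1 = (val i).1.
Proof.
have [s s_odd] := exists_odd; have ss := odd_transM s_odd s_odd.
have s1 : s * s * s \in symT n :\: altT n.
  move: (s_odd); case/setDP: s_odd => /imsetP[g _ ->] _.
  by rewrite -!trans_of_permM !odd_transE !odd_permM addbb.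
by rewrite -{4}(phi_odd i s1) !endoM (phi_odd i s_odd).
Qed.

Lemma phi_index_mull i : (val i).1 * (val i).2 = (val i).2.
Proof.
have [s s_odd] := exists_odd; have [c c_sing] := exists_sing.
have sc : s * c \notin symT n by rewrite symTM negb_and c_sing orbT.
by rewrite -{2}(phi_sing i sc) endoM (phi_odd i s_odd) (phi_sing i c_sing).
Qed.

Lemma phi_index_mulr i : (val i).2 * (val i).1 = (val i).2.
Proof.
have [s s_odd] := exists_odd; have [c c_sing] := exists_sing.
have cs : c * s \notin symT n by rewrite symTM negb_and c_sing.
by rewrite -{2}(phi_sing i cs) endoM (phi_odd i s_odd) (phi_sing i c_sing).
Qed.

Lemma phi_index_idem i : (val i).2 * (val i).2 = (val i).2.
Proof.
have [c c_sing] := exists_sing.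
have cc : c * c \notin symT n by rewrite symTM negb_and c_sing.
by rewrite -{3}(phi_sing i cc) endoM (phi_sing i c_sing).
Qed.

(** An idempotent permutation is the identity, so the component e is either the
    identity or singular. *)
Lemma phi_index_sing i : (val i).2 != 1 -> (val i).2 \notin symT n.
Proof. by apply: contra => /(idempotent_perm (phi_index_idem i)) ->. Qed.

Lemma phi_index_id i : (val i).2 = 1 -> (val i).1 = 1.
Proof. by move=> e1; have := phi_index_mull i; rewrite e1 mulg1. Qed.

Lemma perm_index_sq i : (val i).1 \in symT n -> (val i).1 * (val i).1 = 1.
Proof.
move=> t_sym; apply: idempotent_perm; last by rewrite symTM t_sym.
by rewrite mulgA phi_index_cube.
Qed.

Lemma phi_inj : injective (@phi n).
Proof.
move=> i j ij; apply/val_inj.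
have [s s_odd] := exists_odd; have [c c_sing] := exists_sing.
rewrite [val i]surjective_pairing [val j]surjective_pairing; congr (_, _).
  by rewrite -(phi_odd i s_odd) ij (phi_odd j s_odd).
by rewrite -(phi_sing i c_sing) ij (phi_sing j c_sing).
Qed.

Variant phi_type_spec i : Prop :=
| OddType of odd_type i
| EvenType of even_type i
| NpType of np_type i
| TrivialType of trivial_type i.

Lemma phi_typeP i : phi_type_spec i.
Proof.
have [e1|e_neq1] := eqVneq (val i).2 1.
  by constructor 4; rewrite /trivial_type /= (phi_index_id e1) e1 !eqxx.
case: (trans_classP (val i).1) => t_cls.
- by constructor 1; rewrite /odd_type t_cls.
- by constructor 2; rewrite /even_type t_cls.
- by constructor 3.
Qed.

Lemma np_type_sing i : np_type i -> (val i).2 \notin symT n.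
Proof. by rewrite /np_type => t_sing; rewrite -phi_index_mull symTM negb_and t_sing. Qed.

(** An element of odd type sends each of the three classes of maps (odd, even,
    singular) into itself, and phi_{u,f} is constant on these classes. *)
Lemma mul_odd_phi i j : odd_type i -> phi i * phi j = phi j.
Proof.
case/andP=> t_odd /phi_index_sing e_sing; apply: endo_eqP => s; rewrite endoME.
case: (trans_classP s) => s_cls.
- by rewrite (phi_odd i s_cls) !phi_odd.
- by rewrite (phi_alt i s_cls) !phi_alt // odd_transM.
- by rewrite (phi_sing i s_cls) !phi_sing.
Qed.

Lemma even_phi_sym i s : even_type i -> (phi i s \in symT n) = (s \in symT n).
Proof.
case/andP=> t_alt /phi_index_sing e_sing.
case: (trans_classP s) => s_cls.
- rewrite (phi_odd i s_cls) (altT_sub t_alt).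
  by move: s_cls; rewrite inE => /andP[_ ->].
- by rewrite (phi_alt i s_cls) !altT_sub // even_transM.
- by rewrite (phi_sing i s_cls) (negbTE e_sing) (negbTE s_cls).
Qed.

Lemma mul_even_phi i j s : even_type i ->
  (phi i * phi j) s = if s \in symT n then (val j).1 * (val j).1 else (val j).2.
Proof.
move=> i_even; rewrite endoME -(even_phi_sym s i_even).
case: ifPn => [|s_sing]; last by rewrite phi_sing.
rewrite even_phi_sym // => s_sym.
case/andP: i_even => t_alt _; rewrite phi_alt //.
case: (trans_classP s) => s_cls.
- by rewrite phi_odd.
- by rewrite phi_alt // even_transM.
- by rewrite s_sym in s_cls.
Qed.

Lemma np_phi_sing i s : np_type i -> phi i s \notin symT n.
Proof.
move=> i_np; have e_sing := np_type_sing i_np.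
case: (trans_classP s) => s_cls.
- by rewrite phi_odd.
- by rewrite phi_alt // symTM negb_and -[_ \notin _]/(np_type i) i_np.
- by rewrite phi_sing.
Qed.

Lemma mul_np_phi i j s : np_type i -> (phi i * phi j) s = (val j).2.
Proof. by move=> i_np; rewrite endoME phi_sing // np_phi_sing. Qed.

Lemma trivial_phi i s : trivial_type i -> phi i s = 1.
Proof.
case/andP=> /eqP t1 /eqP e1; case: (trans_classP s) => s_cls.
- by rewrite (phi_odd i s_cls).
- by rewrite (phi_alt i s_cls) t1 mulg1.
- by rewrite (phi_sing i s_cls).
Qed.

Lemma mul_trivial_phi i j s : trivial_type i ->
  (phi i * phi j) s = (val j).1 * (val j).1.
Proof. by move=> i_tr; rewrite endoME (trivial_phi s i_tr) (phi_alt j (altT1 n)). Qed.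

Lemma mul_phi_same_type i i' j : same_type i i' -> phi i * phi j = phi i' * phi j.
Proof.
case/or4P=> /andP[H H'].
- by rewrite !mul_odd_phi.
- by apply: endo_eqP => s; rewrite !mul_even_phi.
- by apply: endo_eqP => s; rewrite !mul_np_phi.
- by apply: endo_eqP => s; rewrite !mul_trivial_phi.
Qed.

Lemma phi_image i :
  [set phi i s | s : trans n] =
    [set (val i).1; (val i).1 * (val i).1; (val i).2].
Proof.
apply/setP=> x; apply/imsetP/idP => [[s _ ->]|].
  rewrite !inE; case: (trans_classP s) => s_cls.
  - by rewrite (phi_odd i s_cls) eqxx.
  - by rewrite (phi_alt i s_cls) eqxx orbT.
  - by rewrite (phi_sing i s_cls) eqxx orbT.
have [s s_odd] := exists_odd; have [c c_sing] := exists_sing.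
rewrite !inE -orbA => /or3P[] /eqP->.
- by exists s => //; rewrite phi_odd.
- by exists 1 => //; rewrite phi_alt // altT1.
- by exists c => //; rewrite phi_sing.
Qed.

(** The image is {t, t^2, e}, and t^2 = e already forces t = t^3 = e t = e, so
    the rank is decided by whether t is equal to e and whether t is idempotent. *)
Variant phi_rank_spec i : nat -> Prop :=
| PhiRank1 of (val i).1 = (val i).2 : phi_rank_spec i 1
| PhiRank2 of (val i).1 * (val i).1 = (val i).1 & (val i).1 <> (val i).2 :
    phi_rank_spec i 2
| PhiRank3 of (val i).1 * (val i).1 <> (val i).1 : phi_rank_spec i 3.

Lemma phi_rankP i : phi_rank_spec i (endo_rank (phi i)).
Proof.
rewrite /endo_rank phi_image.
have [te|te] := eqVneq (val i).1 (val i).2.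
  by rewrite te phi_index_idem !setUid cards1; constructor.
have [tt|tt] := eqVneq ((val i).1 * (val i).1) (val i).1.
  by rewrite tt setUid cards2 te; constructor; last apply/eqP.
have tte : (val i).1 * (val i).1 != (val i).2.
  apply: contra_neq te => tte.
  by rewrite -[LHS]phi_index_cube tte phi_index_mulr.
rewrite setUC cardsU1 cards2 eq_sym tt !inE negb_or.
by rewrite eq_sym te eq_sym tte /=; constructor; apply/eqP.
Qed.

Lemma autT_rank (a : endo n) : a \in autT n -> endo_rank a = #|trans n|.
Proof. by rewrite inE => /injectiveP a_inj; rewrite /endo_rank card_imset. Qed.

Lemma endo_rank_max (a : endo n) : endo_rank a <= #|trans n|.
Proof. exact: max_card. Qed.

Lemma psiK (g : 'S_n) : psi g * psi g^-1 = 1.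
Proof. by rewrite -psiM mulgV psi1. Qed.

Lemma endo_rankM_psi (a : endo n) (g : 'S_n) : endo_rank (a * psi g) = endo_rank a.
Proof.
rewrite /endo_rank -[RHS](card_imset _ (@psi_inj _ g)) -imset_comp.
by congr #|pred_of_set _|; apply: eq_imset => s; rewrite endoME.
Qed.

(** Essentiality does not depend on the representative of the orbit: append
    the correcting automorphism to a factorization. Its rank is the largest
    possible, and exceeds that of a because some factor has larger rank. *)
Lemma in_essential_orbit_essential (a : endo n) : in_essential_orbit a -> essential a.
Proof.
case=> _ [b -> b_ess] /imsetP[c /autT_inner[g ->] ->] [w [w_n0 w_rank w_prod]].
apply: b_ess; exists (rcons w (psi g^-1)); split; first by case: w {w_n0 w_rank w_prod}.
  move: w_rank; rewrite endo_rankM_psi all_rcons => w_rank.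
  rewrite w_rank andbT (autT_rank (psi_autT _)).
  case: w w_n0 w_rank {w_prod} => // x w _ /andP[b_lt _].
  exact: leq_trans b_lt (endo_rank_max x).
by rewrite big_rcons /= w_prod -mulgA psiK mulg1.
Qed.

Lemma mul_inessential (a b c : endo n) :
  (endo_rank a < endo_rank b)%N -> (endo_rank a < endo_rank c)%N ->
  b * c = a -> ~ in_essential_orbit a.
Proof.
move=> ab ac abc /in_essential_orbit_essential; apply; exists [:: b; c].
by split=> //=; rewrite ?ab ?ac // !big_cons big_nil mulg1.
Qed.

(** Factor the constant endomorphism with value e as phi_i phi_{id,e}: the
    factors have ranks 3 and 2. *)
Lemma const_endo_inessential i (a : endo n) e :
  np_type i -> endo_rank (phi i) = 3 ->
  (forall s, a s = e) -> e \notin symT n -> ~ in_essential_orbit a.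
Proof.
move=> i_np i_rank aE e_sing.
have ee : e * e = e by have := endoM a 1 1; rewrite !aE => <-.
have a_rank : (endo_rank a <= 1)%N.
  rewrite /endo_rank -(cards1 e); apply/subset_leq_card/subsetP=> x.
  by case/imsetP=> s _ ->; rewrite aE set11.
apply: (@mul_inessential _ (phi i) (phi (phi_one ee))).
- by rewrite i_rank (leq_ltn_trans a_rank).
- case: phi_rankP => [/= e1|//|_]; last exact: leq_ltn_trans a_rank _.
  by rewrite -e1 symT1 in e_sing.
- by apply: endo_eqP => s; rewrite mul_np_phi // aE.
Qed.

Lemma phi_notin_autT i : phi i \notin autT n.
Proof.
rewrite inE; apply/injectivePn.
pose x := Ordinal (ltnW n_gt1); pose y := Ordinal n_gt1.
exists (const_trans x), (const_trans y); last by rewrite !phi_sing ?const_trans_sing.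
by apply/eqP=> /ffunP/(_ x); rewrite !ffunE.
Qed.

End SingularEndomorphisms.

(** Conjugation preserves the classes of odd, even and singular maps. *)
Lemma mul_psi_phi n (g : 'S_n) (i : phi_index n) : psi g * phi i = phi i.
Proof.
apply: endo_eqP => s; rewrite endoME.
have [|s_sing] := boolP (s \in symT n); last first.
  rewrite (phi_sing i s_sing) phi_sing // /psi ffunE.
  by rewrite !symTM (negbTE s_sing) andbF.
case/imsetP=> h _ ->.
have -> : psi g (trans_of_perm h) = trans_of_perm (h ^ g).
  by rewrite ffunE -!trans_of_permM conjgE mulgA.
by rewrite /phi /= !ffunE !odd_transE !altTE odd_permJ.
Qed.

Lemma notin_autT_mul n (a b : endo n) : a \notin autT n -> a * b \notin autT n.
Proof.
rewrite !inE => /injectivePn[x [y xy axy]]; apply/injectivePn.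
by exists x, y => //; rewrite !endoME axy.
Qed.

Lemma in_essential_orbit_psi n (a : endo n) (g : 'S_n) :
  in_essential_orbit a -> in_essential_orbit (a * psi g).
Proof.
case=> _ [b -> b_ess] /imsetP[_ /autT_inner[h ->] ->].
exists (endo_orbit b); first by exists b.
by rewrite -mulgA -psiM; apply: imset_f; apply: psi_autT.
Qed.

(** * Rewriting words to normal form *)

Section Presentation.

Variables (n : nat) (Pi Sigma : {set endo n}).
Hypothesis n_gt1 : (1 < n)%N.
Hypothesis Sigma_transversal : essential_transversal Sigma.
Variables p_od p_ev p_np p_tr : X_Sigma Sigma.
Hypothesis p_od_odd : odd_type (val p_od).
Hypothesis p_ev_even : even_type (val p_ev).
Hypothesis p_np_np : np_type (val p_np).
Hypothesis p_tr_trivial : trivial_type (val p_tr).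
Hypothesis p_ev_rank : endo_rank (phi (val p_ev)) = 3.
Hypothesis p_np_rank : endo_rank (phi (val p_np)) = 3.
Variable R_Pi : seq (X_Pi Pi) -> seq (X_Pi Pi) -> Prop.
Hypothesis R_Pi_presentation : is_presentation R_Pi (@S_eval n Pi).
Variable F : nat.
Hypothesis F_cover : words_cover Pi F.

Local Notation theta := (@theta n Pi Sigma).
Local Notation "v ~~> w" :=
  (cong_closure (R_all F R_Pi p_od p_ev p_np p_tr) v w) (at level 70).
Local Notation p_word := (map (@inr (X_Pi Pi) (X_Sigma Sigma))).
Implicit Types (p r c : X_Sigma Sigma) (u : seq (X_Pi Pi)) (v w : seq (X Pi Sigma)).

Lemma theta_cat v w : theta (v ++ w) = theta v * theta w.
Proof. by rewrite /theta /word_eval big_cat. Qed.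

Lemma S_eval_cat u u' : @S_eval n Pi (u ++ u') = S_eval u * S_eval u'.
Proof. by rewrite /S_eval /word_eval big_cat. Qed.

Lemma theta_q_word u : theta (q_word Sigma u) = psi (S_eval u).
Proof.
elim: u => [|q u IHu]; first by rewrite /theta /S_eval /word_eval !big_nil psi1.
rewrite -cat1s S_eval_cat psiM -IHu /q_word map_cat theta_cat.
by rewrite /theta /S_eval /word_eval !big_seq1.
Qed.

Lemma theta_letter p : theta [:: inr p] = phi (val p).
Proof. by rewrite /theta /word_eval big_seq1. Qed.

Lemma theta_pair p r : theta [:: inr p; inr r] = phi (val p) * phi (val r).
Proof. by rewrite -cat1s theta_cat !theta_letter. Qed.

Lemma theta_triple p r c :
  theta [:: inr p; inr r; inr c] = phi (val p) * (phi (val r) * phi (val c)).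
Proof. by rewrite -cat1s theta_cat theta_letter theta_pair. Qed.

Lemma relation_sound v w : R_all F R_Pi p_od p_ev p_np p_tr v w -> theta v = theta w.
Proof.
case=> [[u [u' [uu' -> ->]]]|].
  rewrite !theta_q_word; congr psi.
  by case: R_Pi_presentation => _ _ _ /(_ u u')[_]; apply; apply: cong_base.
case=> {v w}.
- by move=> q p; rewrite -cat1s theta_cat (theta_q_word [:: q]) theta_letter mul_psi_phi.
- by [].
- by [].
- by move=> p p' r pp'; rewrite !theta_pair (mul_phi_same_type n_gt1 _ pp').
- by move=> p; rewrite theta_pair theta_letter mul_odd_phi.
- move=> p; rewrite theta_pair theta_letter.
  case: phi_rankP => // tt _ _; apply: endo_eqP => s.
  rewrite mul_even_phi //; case: ifPn => [s_sym|]; last by move/phi_sing->.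
  case: (trans_classP s) => s_cls; last by rewrite s_sym in s_cls.
    by rewrite (phi_odd _ s_cls).
  by rewrite (phi_alt _ s_cls).
- move=> p; rewrite theta_triple theta_pair; apply: endo_eqP => s.
  by rewrite endoME !(mul_even_phi n_gt1 _ _ p_ev_even) even_phi_sym.
- move=> p; rewrite theta_triple theta_pair; apply: endo_eqP => s.
  by rewrite endoME (mul_even_phi n_gt1 _ _ p_ev_even) (mul_np_phi n_gt1) // ifN // np_phi_sing.
- move=> p; rewrite theta_triple theta_pair; apply: endo_eqP => s.
  by rewrite endoME !(mul_np_phi n_gt1 _ _ p_np_np).
- move=> p; rewrite theta_triple theta_pair; apply: endo_eqP => s.
  by rewrite endoME !(mul_np_phi n_gt1 _ _ p_np_np).
- rewrite theta_pair theta_letter; apply: endo_eqP => s.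
  by rewrite endoME !trivial_phi.
- rewrite theta_pair theta_letter; apply: endo_eqP => s.
  by rewrite endoME !trivial_phi.
- rewrite theta_pair theta_letter; apply: endo_eqP => s.
  by rewrite endoME !trivial_phi.
- move=> p; rewrite theta_triple theta_pair; apply: endo_eqP => s.
  by rewrite endoME !(mul_np_phi n_gt1 _ _ p_np_np).
- move=> p p_type; rewrite theta_pair theta_letter; apply: endo_eqP => s.
  rewrite mul_trivial_phi // trivial_phi // perm_index_sq //.
  by case/orP: p_type => /andP[]; [case/setDP | move/altT_sub].
Qed.

Lemma theta_sound v w : v ~~> w -> theta v = theta w.
Proof.
elim=> {v w} [v w /relation_sound //|//|//|u v w _ -> _ -> //|v w v' w' _ e _ e'].
by rewrite !theta_cat e e'.
Qed.

Lemma rel_base v w : R_Pi_Sigma F p_od p_ev p_np p_tr v w -> v ~~> w.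
Proof. by move=> vw; apply: cong_base; right. Qed.

Lemma rel_cons x w w' : w ~~> w' -> x :: w ~~> x :: w'.
Proof. exact: cong_cat (cong_refl _ [:: x]). Qed.

Lemma rel_cat2r v v' w : v ~~> v' -> v ++ w ~~> v' ++ w.
Proof. by move/cong_cat; apply; apply: cong_refl. Qed.

Lemma q_word_rel u u' : S_eval u = S_eval u' -> q_word Sigma u ~~> q_word Sigma u'.
Proof.
case: R_Pi_presentation => _ _ _ RP /RP; elim=> {u u'}.
- by move=> u u' uu'; apply: cong_base; left; exists u, u'.
- by move=> u; apply: cong_refl.
- by move=> u u' _; apply: cong_sym.
- by move=> u1 u2 u3 _ u12 _; apply: cong_trans.
- by move=> u1 u2 u1' u2' _ u12 _ u12'; rewrite /q_word !map_cat; apply: cong_cat.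
Qed.

Lemma word_shape w :
  (exists u, w = q_word Sigma u) \/
  (exists ps r u, w ~~> p_word (rcons ps r) ++ q_word Sigma u).
Proof.
elim: w => [|[q|p] w IHw]; first by left; exists [::].
  case: IHw => [[u ->]|[ps [r [u wE]]]]; first by left; exists (q :: u).
  right; exists ps, r, u; apply: cong_trans (rel_cons (inl q) wE) _.
  have [p [ps' ->]] : exists p ps', rcons ps r = p :: ps'.
    by case: ps {wE} => [|p ps]; [exists r, [::] | exists p, (rcons ps r)].
  exact (rel_cat2r (p_word ps' ++ q_word Sigma u) (rel_base (Defs.R1 _ _ _ _ _ q p))).
right; case: IHw => [[u ->]|[ps [r [u wE]]]].
  by exists [::], p, u; apply: cong_refl.
by exists (p :: ps), r, u; exact (rel_cons (inr p) wE).
Qed.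

(** The representative of the type of a letter may replace it whenever another
    letter of X_Sigma follows. *)
Lemma canonical_left p r :
  exists2 c, [\/ c = p_od, c = p_ev, c = p_np | c = p_tr] &
    [:: inr p; inr r] ~~> [:: inr c; inr r].
Proof.
have [c c_canon pc] : exists2 c, [\/ c = p_od, c = p_ev, c = p_np | c = p_tr] &
    same_type (val p) (val c).
  rewrite /same_type; case: (phi_typeP n_gt1 (val p)) => p_type.
  - by exists p_od; [constructor 1 | rewrite p_type p_od_odd].
  - by exists p_ev; [constructor 2 | rewrite p_type p_ev_even orbT].
  - by exists p_np; [constructor 3 | rewrite p_type p_np_np !orbT].
  - by exists p_tr; [constructor 4 | rewrite p_type p_tr_trivial !orbT].
by exists c => //; apply/rel_base/R4.
Qed.

(** The multiplication table of the four representatives, acting from the left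
    on a letter: only one of two adjacent representatives survives. *)
Lemma triple_rel p r1 r2 :
  exists c, [:: inr p; inr r1; inr r2] ~~> [:: inr c; inr r2].
Proof.
have [c c_canon rc] := canonical_left p r1.
have [d d_canon rd] := canonical_left r1 r2.
suff [a cd] : exists a, [:: inr c; inr d; inr r2] ~~> [:: inr a; inr r2].
  exists a; apply: cong_trans (rel_cat2r [:: inr r2] rc) _.
  exact (cong_trans (rel_cons (inr c) rd) cd).
case: c_canon => ->{rc}.
- exists d; exact (rel_cat2r [:: inr r2] (rel_base (R5 _ _ _ _ _ _ d))).
- case: d_canon => ->{rd}.
  + exists p_ev; exact (rel_cons (inr p_ev) (rel_base (R5 _ _ _ _ _ _ r2))).
  + exists p_ev; exact (rel_base (R7 _ _ _ _ _ _ r2)).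
  + exists p_np; exact (rel_base (R8b _ _ _ _ _ _ r2)).
  + exists p_tr; exact (rel_cat2r [:: inr r2] (rel_base (R9a _ _ _ _ _ _))).
- case: d_canon => ->{rd}.
  + exists p_np; exact (rel_cons (inr p_np) (rel_base (R5 _ _ _ _ _ _ r2))).
  + exists p_np; exact (rel_base (R8a _ _ _ _ _ _ r2)).
  + exists p_np; exact (rel_base (R8c _ _ _ _ _ _ r2)).
  + exists p_tr; exact (rel_cat2r [:: inr r2] (rel_base (R9b _ _ _ _ _ _))).
- case: d_canon => ->{rd}.
  + exists p_tr; exact (rel_cons (inr p_tr) (rel_base (R5 _ _ _ _ _ _ r2))).
  + have tr_ev : [:: inr p_tr; inr p_ev] ~~> [:: inr p_tr].
      by apply/rel_base/R10b; rewrite p_ev_even orbT.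
    exists p_tr; exact (rel_cat2r [:: inr r2] tr_ev).
  + exists p_np; exact (rel_base (R10a _ _ _ _ _ _ r2)).
  + exists p_tr; exact (rel_cat2r [:: inr r2] (rel_base (R9c _ _ _ _ _ _))).
Qed.

Lemma p_word_rel ps r :
  ps = [::] \/ exists c, p_word (rcons ps r) ~~> [:: inr c; inr r].
Proof.
elim: ps => [|p ps [->|[c IHps]]]; [by left | right..].
  by exists p; apply: cong_refl.
have [d cd] := triple_rel p c r; exists d.
exact (cong_trans (rel_cons (inr p) IHps) cd).
Qed.

Lemma letter_essential p : in_essential_orbit (phi (val p)).
Proof.
case: Sigma_transversal => Sigma_ess _; have [_ _] := Sigma_ess _ (valP p).
by case=> O [O_ess _ pO]; exists O.
Qed.

(** Sigma meets each essential orbit once, so distinct letters have values in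
    distinct orbits. *)
Lemma letter_unique p r (g : 'S_n) : phi (val p) * psi g = phi (val r) -> p = r.
Proof.
move=> pr; apply/val_inj/(phi_inj n_gt1).
case: Sigma_transversal => Sigma_ess Sigma1.
have [_ _ [O [O_ess O_aut pO]]] := Sigma_ess _ (valP p).
have rO : phi (val r) \in O.
  rewrite -pr; case: O_ess pO => b -> _ /imsetP[_ /autT_inner[h ->] ->].
  by rewrite -mulgA -psiM; apply: imset_f; apply: psi_autT.
have /eqP/cards1P[a aE] := Sigma1 _ O_ess O_aut.
have in_a x : x \in Sigma -> x \in O -> x = a.
  by move=> xS xO; apply/set1P; rewrite -aE inE xS.
by rewrite (in_a _ (valP p) pO) (in_a _ (valP r) rO).
Qed.

Lemma const_inessential (a : endo n) (e : trans n) :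
  (forall s, a s = e) -> e \notin symT n -> ~ in_essential_orbit a.
Proof. exact: const_endo_inessential p_np_np p_np_rank. Qed.

Lemma trivial_letter p : trivial_type (val p) -> p = p_tr.
Proof.
move=> p_type; apply: (@letter_unique _ _ 1); rewrite psi1 mulg1.
by apply: endo_eqP => s; rewrite !trivial_phi.
Qed.

Lemma id_letter p : (val (val p)).2 = 1 -> p = p_tr.
Proof.
move=> e1; apply: trivial_letter.
by rewrite /trivial_type /= (phi_index_id n_gt1 e1) e1 !eqxx.
Qed.

(** A phi_{e,e} with e singular is not essential, which leaves e = id. *)
Lemma rank1_letter p : (val (val p)).1 = (val (val p)).2 -> p = p_tr.
Proof.
move=> te; have [/id_letter //|e_neq1] := eqVneq (val (val p)).2 1.
have phi_const s : phi (val p) s = (val (val p)).2.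
  case: (trans_classP s) => s_cls.
  - by rewrite (phi_odd _ s_cls).
  - by rewrite (phi_alt _ s_cls) te phi_index_idem.
  - by rewrite (phi_sing _ s_cls).
case: (const_inessential phi_const (phi_index_sing n_gt1 e_neq1)).
exact: letter_essential.
Qed.

(** After replacing p by the representative c of its type, the value of c r is
    computed by the type of c, and compared with that of r. *)
Lemma pair_rel p r :
  (exists r', [:: inr p; inr r] ~~> [:: inr r']) \/
  ~ in_essential_orbit (theta [:: inr p; inr r]).
Proof.
have [c c_canon pc] := canonical_left p r.
suff [[r' cr]|cr] : (exists r', [:: inr c; inr r] ~~> [:: inr r']) \/
    ~ in_essential_orbit (theta [:: inr c; inr r]).
- by left; exists r'; apply: cong_trans pc cr.
- by right; rewrite (theta_sound pc).
case: c_canon => ->{pc}.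
- by left; exists r; apply: rel_base; apply: R5.
- case rank_r: _ / (phi_rankP n_gt1 (val r)) => [te|_ _|tt].
  + left; exists p_tr; rewrite (rank1_letter te); apply: rel_base; exact: R9a.
  + by left; exists r; apply/rel_base/R6.
  + right; rewrite theta_pair.
    have rank_le2 : (endo_rank (phi (val p_ev) * phi (val r))%g <= 2)%N.
      apply: (@leq_trans #|[set (val (val r)).1 * (val (val r)).1; (val (val r)).2]|); last first.
        by rewrite cards2; case: (_ != _).
      apply/subset_leq_card/subsetP=> x /imsetP[s _ ->].
      by rewrite mul_even_phi // !inE; case: ifP; rewrite eqxx ?orbT.
    by apply: (@mul_inessential _ _ (phi (val p_ev)) (phi (val r)));
       rewrite ?p_ev_rank ?rank_r.
- have [e1|e_neq1] := eqVneq (val (val r)).2 1.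
    left; exists p_tr; rewrite (id_letter e1); apply: rel_base; exact: R9b.
  right; rewrite theta_pair; apply: const_inessential (phi_index_sing n_gt1 e_neq1).
  by move=> s; rewrite mul_np_phi.
- case: (phi_typeP n_gt1 (val r)) => r_type.
  + by left; exists p_tr; apply/rel_base/R10b; rewrite r_type.
  + by left; exists p_tr; apply/rel_base/R10b; rewrite r_type orbT.
  + right; rewrite theta_pair.
    apply: (const_inessential (e := (val (val r)).1 * (val (val r)).1)).
      by move=> s; rewrite mul_trivial_phi.
    by rewrite symTM negb_and -[_ \notin _]/(np_type (val r)) r_type.
  + left; exists p_tr; rewrite (trivial_letter r_type); apply: rel_base; exact: R9c.
Qed.

(** * Normal forms and their values *)

(** Only inessential pairs are kept, so that the value of a normal form tells
    its length. *)
Definition p_normal (m : seq (X Pi Sigma)) : Prop :=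
  (exists r, m = [:: inr r]) \/
  (exists c r, m = [:: inr c; inr r] /\ ~ in_essential_orbit (theta m)).

Lemma p_word_normal ps r : exists2 m, p_normal m & p_word (rcons ps r) ~~> m.
Proof.
case: (p_word_rel ps r) => [->|[c cE]].
  by exists [:: inr r]; [left; exists r | apply: cong_refl].
case: (pair_rel c r) => [[r' r'E]|c_iness].
  by exists [:: inr r']; [left; exists r' | apply: cong_trans cE r'E].
by exists [:: inr c; inr r] => //; right; exists c, r.
Qed.

Lemma word_normal w :
  (exists u, w = q_word Sigma u) \/
  (exists m u, p_normal m /\ w ~~> m ++ q_word Sigma u).
Proof.
case: (word_shape w) => [|[ps [r [u wE]]]]; first by left.
have [m m_normal mE] := p_word_normal ps r.
by right; exists m, u; split=> //; apply: cong_trans wE (rel_cat2r _ mE).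
Qed.

Lemma p_normal_notin_autT m : p_normal m -> theta m \notin autT n.
Proof.
case=> [[r ->]|[c [r [-> _]]]]; first by rewrite theta_letter phi_notin_autT.
by rewrite theta_pair notin_autT_mul ?phi_notin_autT.
Qed.

(** Being in an essential orbit is invariant under right multiplication by
    automorphisms, which excludes that one side is a single letter and the
    other one an inessential pair. *)
Lemma p_normal_rel m m' u :
  p_normal m -> p_normal m' -> theta (m ++ q_word Sigma u) = theta m' ->
  m ++ q_word Sigma u ~~> m'.
Proof.
move=> m_normal m'_normal.
(* The second and third families of relations are only given for short tails. *)
have [u' u'_size u'E] := F_cover (S_eval u).
have uu' : m ++ q_word Sigma u ~~> m ++ q_word Sigma u'.
  by apply: cong_cat (cong_refl _ _) (q_word_rel _); rewrite u'E.
rewrite (theta_sound uu') => mm'; apply: cong_trans uu' _.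
have mm'psi : theta m * psi (S_eval u') = theta m'.
  by rewrite -mm' theta_cat theta_q_word.
case: m_normal m'_normal mm' mm'psi => [[r ->]|[c [r [-> m_iness]]]].
  case=> [[r' ->]|[c' [r' [-> m'_iness]]]] mm'; rewrite theta_letter => mm'psi.
    rewrite theta_letter in mm'psi; have rr' := letter_unique mm'psi; subst r'.
    by apply: rel_base; apply: Defs.R2.
  by case: m'_iness; rewrite -mm'psi; apply/in_essential_orbit_psi/letter_essential.
case=> [[r' ->]|[c' [r' [-> m'_iness]]]] mm' mm'psi.
  case: m_iness; rewrite -(mulg1 (theta _)) -(psiK (S_eval u')) mulgA mm'psi.
  by rewrite theta_letter; apply/in_essential_orbit_psi/letter_essential.
by apply: rel_base; apply: Defs.R3.
Qed.

Lemma theta_complete v w : theta v = theta w -> v ~~> w.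
Proof.
case: (word_normal v) => [[u ->]|[m [u [m_normal vE]]]];
  case: (word_normal w) => [[u' ->]|[m' [u' [m'_normal wE]]]].
- by rewrite !theta_q_word => /psi_faithful/q_word_rel.
- rewrite theta_q_word (theta_sound wE) theta_cat theta_q_word => uE.
  by have := notin_autT_mul (psi (S_eval u')) (p_normal_notin_autT m'_normal);
     rewrite -uE psi_autT.
- rewrite theta_q_word (theta_sound vE) theta_cat theta_q_word => uE.
  by have := notin_autT_mul (psi (S_eval u)) (p_normal_notin_autT m_normal);
     rewrite uE psi_autT.
rewrite (theta_sound vE) (theta_sound wE) => mm'.
apply: cong_trans vE _; apply: cong_trans (cong_sym wE).
(* Moving the tail of w to the left hand side leaves a normal form on the right. *)
have [x _ xE] := F_cover (S_eval u * (S_eval u')^-1).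
have xu' : q_word Sigma u ~~> q_word Sigma (x ++ u').
  by apply: q_word_rel; rewrite S_eval_cat xE mulgKV.
apply: cong_trans (cong_cat (cong_refl _ _) xu') _.
rewrite /q_word map_cat catA; apply: rel_cat2r; apply: p_normal_rel => //.
move: mm'; rewrite !theta_cat !theta_q_word xE psiM mulgA => ->.
by rewrite -mulgA psiK mulg1.
Qed.

(** Downward induction on the rank: an essential singular element is an
    automorphic translate of a letter, an inessential one is a product of
    elements of larger rank. *)
Lemma theta_surjective a : exists w, theta w = a.
Proof.
have psi_image g : exists w, theta w = psi g.
  by have [u _ <-] := F_cover g; exists (q_word Sigma u); rewrite theta_q_word.
have [k] := ubnP (#|trans n| - endo_rank a); elim: k a => // k IHk a.
rewrite ltnS => a_rank.
have [/autT_inner[g ->] //|a_sing] := boolP (a \in autT n).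
case: (classic (essential a)) => [a_ess|/NNPP[w [_ w_rank w_prod]]].
  have a_orbit : a \in endo_orbit a.
    by apply/imsetP; exists 1; rewrite ?mulg1 // -psi1 psi_autT.
  have orbit_ess : essential_orbit (endo_orbit a) by exists a.
  have orbit_aut : endo_orbit a <> autT n.
    by move=> aE; rewrite aE (negbTE a_sing) in a_orbit.
  case: Sigma_transversal => Sigma_phi /(_ _ orbit_ess orbit_aut)/eqP/cards1P[b bE].
  have /setIP[b_Sigma] : b \in Sigma :&: endo_orbit a by rewrite bE set11.
  case/imsetP=> _ /autT_inner[g ->] ab.
  have [i bi _] := Sigma_phi _ b_Sigma; rewrite bi in b_Sigma.
  have [w wE] := psi_image g^-1.
  exists (inr (Sub i b_Sigma : X_Sigma Sigma) :: w).
  rewrite -cat1s theta_cat theta_letter wE SubK -bi ab.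
  by rewrite -mulgA psiK mulg1.
rewrite -w_prod; elim: w w_rank {w_prod} => [|b w IHw] /=.
  by exists [::]; rewrite /theta /word_eval !big_nil.
case/andP=> b_rank /IHw[v vE].
have [|x xE] := IHk b.
  by apply: leq_trans a_rank; rewrite ltn_sub2l // (leq_trans b_rank) ?endo_rank_max.
by exists (x ++ v); rewrite theta_cat xE vE big_cons.
Qed.

End Presentation.

Theorem theorem4p3 (n : nat) (hn : (5 <= n)%N)
  (Pi Sigma : {set endo n})
  (hPi : generates Pi (autT n))
  (hSigma : essential_transversal Sigma)
  (p_od p_ev p_np p_tr : X_Sigma Sigma)
  (hod : odd_type (val p_od)) (hod3 : endo_rank (phi (val p_od)) = 3)
  (hev : even_type (val p_ev)) (hev3 : endo_rank (phi (val p_ev)) = 3)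
  (hnp : np_type (val p_np)) (hnp3 : endo_rank (phi (val p_np)) = 3)
  (htr : trivial_type (val p_tr))
  (R_Pi : seq (X_Pi Pi) -> seq (X_Pi Pi) -> Prop)
  (hR_Pi : is_presentation R_Pi (@S_eval n Pi))
  (F : nat) (hF : is_F_Pi Pi F) :
  is_presentation (R_all F R_Pi p_od p_ev p_np p_tr) (@theta n Pi Sigma).
Proof.
have n_gt1 : 1 < n by apply: leq_trans hn.
have [F_cover _] := hF.
split.
- exact: big_nil.
- exact: theta_cat.
- by move=> x; apply: (theta_surjective hSigma F_cover).
- move=> v w; split; last exact: theta_sound.
  exact: (theta_complete n_gt1 hSigma hod hev hnp htr hev3 hnp3 hR_Pi F_cover).
Qed.
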